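(* Let $\widetilde W$ be an $N\times N$ weight matrix whose right Fourier algebra $\mathcal F_R(\widetilde W)$ consists only of operators with diagonal coefficients. Let $A\in\mathcal A$, $T(x)=e^{Ax}$, and $W(x)=T(x)\widetilde W(x)T(x)^*$. Then $\mathcal D(W)\subset T(x)\,\mathcal D(\widetilde W)\,T(x)^{-1}$.
   Context: $\mathcal A=\{\sum_{j=1}^{\lfloor N/2\rfloor}m_jE_{2j-1,2j}+\sum_{j=1}^{\lfloor (N-1)/2\rfloor}n_jE_{2j+1,2j}: m_j,n_j\in\mathbb C\}$, where $E_{s,t}$ are matrix units; note $A^2=0$ so $e^{Ax}=I+Ax$. Weight matrices are smooth a.e. positive definite matrix functions on an interval with finite moments (with standing decay assumptions: $W^{(n)}$ decays exponentially at infinity and $W^{(n)}p_n$ has finite moments for some scalar polynomial $p_n$); $\langle P,Q\rangle_W=\int PWQ^*dx$; $(P_n)$ monic orthogonal polynomials. Differential operators act on the right: $P\cdot\sum_j\partial^jF_j=\sum_j\partial^j(P)F_j$. $\mathcal D(W)$: operators with matrix polynomial coefficients with $P_n\cdot D=\Lambda_n(D)P_n$ for all $n$, $\Lambda_n(D)$ constant matrices. $\mathcal F_R(W)$: operators $\mathfrak D$ with polynomial coefficients having a $W$-adjoint $\mathfrak D^\dagger$ (i.e. $\langle P\cdot\mathfrak D,Q\rangle_W=\langle P,Q\cdot\mathfrak D^\dagger\rangle_W$ for all matrix polynomials $P,Q$) with polynomial coefficients. *)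

(* Defs.v *)
From HB Require Import structures.
From mathcomp Require Import all_boot all_order all_algebra.
From mathcomp Require Import all_classical all_reals all_analysis.
From mathcomp Require Import complex.
Set Implicit Arguments. Unset Strict Implicit. Unset Printing Implicit Defensive.
Import Order.TTheory GRing.Theory Num.Theory.
Import numFieldNormedType.Exports.
Local Open Scope ring_scope.
Local Open Scope classical_set_scope.

Notation mpoly R N := ('M[{poly (complex R)}]_N).

Section Defs.
Variables (R : realType) (N : nat).
Local Notation C := R[i].
Local Notation mpoly := (mpoly R N).
Local Notation mu := (@lebesgue_measure R).

Definition cx (x : R) : C := Complex x 0.

Definition ctr m n (M : 'M[C]_(m, n)) : 'M[C]_(n, m) := (map_mx conjc M)^T.


Definition meval (P : mpoly) (x : R) : 'M[C]_N := map_mx (fun p => p.[cx x]) P.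

Definition mderiv (j : nat) (P : mpoly) : mpoly := map_mx (fun p => derivn j p) P.

Definition mdeg_lt (n : nat) (P : mpoly) : Prop := forall i k, (size (P i k) <= n)%N.

Definition mmonic (n : nat) (P : mpoly) : Prop :=
  forall i k, (size (P i k) <= n.+1)%N /\ (P i k)`_n = (i == k)%:R.

(* differential operator  sum_j d^j F_j  with matrix polynomial coefficients,
   given by its coefficient list (F_0, F_1, ...) *)
Definition diffop := seq mpoly.

Definition opact (D : diffop) (P : mpoly) : mpoly :=
  \sum_(j < size D) (mderiv j P *m D`_j).

Definition cintegral (S : set R) (f : R -> C) : C :=
  Complex (Rintegral mu S (fun x => complex.Re (f x)))
          (Rintegral mu S (fun x => complex.Im (f x))).

Definition cintegrable (S : set R) (f : R -> C) : Prop :=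
  mu.-integrable S (EFin \o (fun x => complex.Re (f x))) /\
  mu.-integrable S (EFin \o (fun x => complex.Im (f x))).

Definition ipW (S : set R) (W : R -> 'M[C]_N) (P Q : mpoly) : 'M[C]_N :=
  \matrix_(i, k) cintegral S (fun x => (meval P x *m W x *m ctr (meval Q x)) i k).

Definition wderiv (n : nat) (W : R -> 'M[C]_N) (x : R) : 'M[C]_N :=
  \matrix_(i, k) Complex (derive1n n (fun y => complex.Re (W y i k)) x)
                         (derive1n n (fun y => complex.Im (W y i k)) x).

Definition posdef (M : 'M[C]_N) : Prop :=
  M = ctr M /\ forall v : 'rV[C]_N, v != 0 -> 0 < (v *m M *m ctr v) 0 0.

(* W is a weight matrix on the (nondegenerate) interval S, including the
   standing assumptions (smoothness, a.e. positive definiteness, finite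
   moments, exponential decay at infinity of W^(n), finite moments of
   W^(n) p_n for some nonzero scalar polynomial p_n). *)
Definition weight_matrix (I : interval R) (W : R -> 'M[C]_N) : Prop :=
  let S : set R := [set` I] in
  (exists a b, a < b /\ S a /\ S b) /\
  (forall n i k x, interior S x ->
     derivable (derive1n n (fun y => complex.Re (W y i k))) x 1 /\
     derivable (derive1n n (fun y => complex.Im (W y i k))) x 1) /\
  {ae mu, forall x, S x -> posdef (W x)} /\
  (forall m i k, cintegrable S (fun x => (cx x) ^+ m * W x i k)) /\
  (forall n, exists c : R, exists M : R, exists r0 : R, 0 < c /\
     forall x, S x -> r0 <= `|x| -> forall i k,
       `|complex.Re (wderiv n W x i k)| <= M * expR (- (c * `|x|)) /\
       `|complex.Im (wderiv n W x i k)| <= M * expR (- (c * `|x|))) /\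
  (forall n, exists p : {poly C}, p != 0 /\
     forall m i k, cintegrable S (fun x => (cx x) ^+ m * p.[cx x] * wderiv n W x i k)).

Definition monic_OP (I : interval R) (W : R -> 'M[C]_N) (n : nat) (P : mpoly) : Prop :=
  mmonic n P /\ forall Q, mdeg_lt n Q -> ipW [set` I] W P Q = 0.

Definition in_DW (I : interval R) (W : R -> 'M[C]_N) (D : diffop) : Prop :=
  forall n P, monic_OP I W n P ->
    exists L : 'M[C]_N, opact D P = map_mx polyC L *m P.

Definition in_FRW (I : interval R) (W : R -> 'M[C]_N) (D : diffop) : Prop :=
  exists Dd : diffop, forall P Q : mpoly,
    ipW [set` I] W (opact D P) Q = ipW [set` I] W P (opact Dd Q).

Definition diag_coeffs (D : diffop) : Prop := forall j, is_diag_mx D`_j.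

(* A in the class calA: only entries (s,t) with s odd and |s - t| = 1
   (1-based), i.e. s even (0-based) and t = s +- 1, may be nonzero *)
Definition in_calA (A : 'M[C]_N) : Prop :=
  forall s t : 'I_N, A s t != 0 ->
    ~~ odd s /\ ((t == s.+1 :> nat) \/ (s == t.+1 :> nat)).

(* T(x) = e^{Ax} = I + A x  (A^2 = 0), as a matrix polynomial *)
Definition Tpoly (A : 'M[C]_N) : mpoly :=
  \matrix_(i, k) ((i == k)%:R%:P + A i k *: 'X).

End Defs.

(* Main.v *)
(* Multiplication by x is symmetric for the inner product and taking the commutator
   with x lowers the order of a differential operator.  An operator D in D(W) preserves
   every space of polynomials of degree < n together with its orthogonal complement, so
   it has an adjoint on matrix polynomials; iterated commutators of this adjoint with x
   vanish, hence it is itself a differential operator with polynomial coefficients.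
   Conjugating by T puts E = T^-1 D T and its adjoint in the Fourier algebra of the
   weight Wt, so both are diagonal.  As A i j * A j k = 0, the diagonal of D is E; hence
   neither E nor, likewise, its adjoint raises degrees, and such an operator has the
   monic orthogonal polynomials of Wt as eigenfunctions. *)
Require Import Defs.
From HB Require Import structures.
From mathcomp Require Import all_boot all_order all_algebra.
From mathcomp Require Import all_classical all_reals all_analysis.
From mathcomp Require Import complex.
Import Order.TTheory GRing.Theory Num.Theory.
Local Open Scope ring_scope.
Local Open Scope classical_set_scope.

Set Implicit Arguments. Unset Strict Implicit. Unset Printing Implicit Defensive.

(** * Matrix polynomials and differential operators acting on the right *)

Section DifferentialOperators.
Variables (R : realType) (N : nat).
Local Notation C := R[i].
Local Notation mpoly := (mpoly R N).
Local Notation lift := (map_mx (@polyC C)).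
Implicit Types (P Q : mpoly) (M : 'M[C]_N) (s : diffop R N).

Definition left_linear (phi : mpoly -> mpoly) :=
  forall M P Q, phi (lift M *m P + Q) = lift M *m phi P + phi Q.

Definition coefmx k P : 'M[C]_N := map_mx (fun p : {poly C} => p`_k) P.

Lemma lift1 : lift 1%:M = 1%:M :> mpoly.
Proof. by rewrite map_scalar_mx. Qed.

Lemma liftM M M' : lift (M *m M') = lift M *m lift M' :> mpoly.
Proof. by rewrite map_mxM. Qed.

Lemma liftN M : lift (- M) = - lift M :> mpoly.
Proof. by rewrite map_mxN. Qed.

Lemma coefmxD k P Q : coefmx k (P + Q) = coefmx k P + coefmx k Q.
Proof. by apply/matrixP => i j; rewrite !mxE coefD. Qed.

Lemma coefmxB k P Q : coefmx k (P - Q) = coefmx k P - coefmx k Q.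
Proof. by apply/matrixP => i j; rewrite !mxE coefB. Qed.

Lemma coefmx_liftM k M P : coefmx k (lift M *m P) = M *m coefmx k P.
Proof.
apply/matrixP => i j; rewrite !mxE coef_sum.
by apply: eq_bigr => l _; rewrite !mxE coefCM.
Qed.

Lemma mdeg_ltP n P : mdeg_lt n P <-> forall k, (n <= k)%N -> coefmx k P = 0.
Proof.
split=> [dP k nk|dP i j].
  by apply/matrixP => i j; rewrite !mxE nth_default // (leq_trans (dP i j)).
apply/leq_sizeP => k nk.
by have /matrixP/(_ i j) := dP k nk; rewrite !mxE.
Qed.

Lemma mdeg_lt_lin n M P Q :
  mdeg_lt n P -> mdeg_lt n Q -> mdeg_lt n (lift M *m P + Q).
Proof.
move=> /mdeg_ltP dP /mdeg_ltP dQ; apply/mdeg_ltP => k nk.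
by rewrite coefmxD coefmx_liftM dP // dQ // mulmx0 addr0.
Qed.

Lemma mdeg_lt0 P : mdeg_lt 0 P -> P = 0.
Proof.
move=> dP; apply/matrixP => i j; rewrite mxE.
by apply/eqP; rewrite -size_poly_eq0 -leqn0; exact: dP.
Qed.

Lemma mdeg_lt_zero n : mdeg_lt n (0 : mpoly).
Proof. by move=> i j; rewrite mxE size_poly0. Qed.

Lemma mdeg_ltW m n P : (m <= n)%N -> mdeg_lt m P -> mdeg_lt n P.
Proof. by move=> mn dP i j; rewrite (leq_trans (dP i j)). Qed.

Lemma mdeg_lt_ex P : exists n, mdeg_lt n P.
Proof.
exists (\max_i \max_j size (P i j))%N => i j.
rewrite (bigD1 i) //= (bigD1 j) //=.
by rewrite (leq_trans _ (leq_maxl _ _)) // leq_maxl.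
Qed.

Lemma mmonicP n P :
  mmonic n P <-> mdeg_lt n.+1 P /\ coefmx n P = 1%:M.
Proof.
split=> [mP|[dP cP] i j].
  by split=> [i j|]; [case: (mP i j)|apply/matrixP => i j; rewrite !mxE; case: (mP i j)].
by split; [exact: dP|have /matrixP/(_ i j) := cP; rewrite !mxE].
Qed.

(** Cancelling the leading coefficient against a monic [B] is the induction step on degrees in all
    expansions along orthogonal polynomials below. *)
Lemma mdeg_ltS_monic n (B : mpoly) P : mmonic n B -> mdeg_lt n.+1 P ->
  mdeg_lt n (P - lift (coefmx n P) *m B).
Proof.
move=> /mmonicP[/mdeg_ltP dB cB] /mdeg_ltP dP; apply/mdeg_ltP => k.
rewrite leq_eqVlt => /predU1P[<-|nk]; rewrite coefmxB coefmx_liftM.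
  by rewrite cB mulmx1 subrr.
by rewrite dP // dB // mulmx0 subr0.
Qed.

Lemma left_linearD phi P Q : left_linear phi -> phi (P + Q) = phi P + phi Q.
Proof. by move=> /(_ 1%:M P Q); rewrite lift1 !mul1mx. Qed.

Lemma left_linear0 phi : left_linear phi -> phi 0 = 0.
Proof.
move=> h; have := left_linearD 0 0 h; rewrite addr0 => /esym/eqP.
by rewrite -subr_eq0 addrK => /eqP.
Qed.

Lemma left_linearM phi M P : left_linear phi -> phi (lift M *m P) = lift M *m phi P.
Proof. by move=> h; rewrite -[_ *m P]addr0 h left_linear0 // addr0. Qed.

Lemma mpoly_coefE n P : mdeg_lt n P ->
  P = \sum_(k < n) 'X^k *: lift (coefmx k P).
Proof.
move=> dP; apply/matrixP => i j; rewrite summxE.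
rewrite -[LHS]coefK poly_def.
rewrite (big_ord_widen n (fun k => (P i j)`_k *: 'X^k)) ?dP // big_mkcond.
apply: eq_bigr => k _; rewrite !mxE mulrC mul_polyC.
by case: ltnP => // h; rewrite nth_default // scale0r.
Qed.

(* A map commuting with left constants and with x is right multiplication by its value
   at 1. *)
Lemma left_linear_comm_eq0 phi : left_linear phi ->
  (forall P, phi ('X *: P) = 'X *: phi P) -> phi 1%:M = 0 -> forall P, phi P = 0.
Proof.
move=> lphi Xphi phi1 P; have [n /mpoly_coefE ->] := mdeg_lt_ex P.
rewrite (big_morph phi (id1 := 0) (op1 := +%R)); last exact: left_linear0.
  rewrite big1 // => k _.
  have -> m Q : phi ('X^m *: Q) = 'X^m *: phi Q.
    by elim: m => [|m IH]; rewrite ?expr0 ?scale1r // exprS -!scalerA Xphi IH.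
  by rewrite -[lift _]mulmx1 left_linearM // phi1 mulmx0 scaler0.
by move=> ? ?; exact: left_linearD.
Qed.

Lemma mderiv_lin j M P Q : mderiv j (lift M *m P + Q) = lift M *m mderiv j P + mderiv j Q.
Proof.
apply/matrixP => a b; rewrite !mxE derivnD linear_sum; congr (_ + _).
by apply: eq_bigr => k _; rewrite !mxE /= !mul_polyC derivnZ.
Qed.

Lemma opact_linear s : left_linear (opact s).
Proof.
move=> M P Q; rewrite /opact mulmx_sumr -big_split; apply: eq_bigr => j _ /=.
by rewrite mderiv_lin mulmxDl mulmxA.
Qed.

Lemma mderiv0 P : mderiv 0 P = P.
Proof. by apply/matrixP => a b; rewrite mxE. Qed.

Lemma opact_cons F s P :
  opact (F :: s) P = P *m F + \sum_(j < size s) mderiv j.+1 P *m s`_j.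
Proof. by rewrite /opact big_ord_recl /= mderiv0. Qed.

Lemma mderiv_mulX j P :
  mderiv j.+1 ('X *: P) = 'X *: mderiv j.+1 P + mderiv j P *+ j.+1.
Proof.
apply/matrixP => a b; rewrite [RHS]mxE mulmxnE !mxE addrC mulrC.
by have := derivnMXaddC j (P a b) 0; rewrite addr0 => ->; rewrite mulrC.
Qed.

(** By Leibniz, d^(j+1)(xP) - x d^(j+1)P = (j+1) d^j P, and the order zero term [F] commutes with x.
    The resulting list is one shorter, which drives the inductions on the order. *)
Lemma opact_commX F s P :
  opact (F :: s) ('X *: P) - 'X *: opact (F :: s) P
  = opact (mkseq (fun j => s`_j *+ j.+1) (size s)) P.
Proof.
rewrite !opact_cons scalerDr scalemxAl opprD addrACA subrr add0r scaler_sumr -sumrB.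
rewrite /opact size_mkseq; apply: eq_bigr => j _.
rewrite mderiv_mulX nth_mkseq // mulmxDl scalemxAl addrC addKr.
by rewrite -[LHS]/(mulmxr _ _) (raddfMn (mulmxr _)) -[RHS]/(mulmx _ _) (raddfMn (mulmx _)).
Qed.

(* [d^(j+1) G_j/(j+1)] has commutator [d^j G_j] with x. *)
Lemma opact_of_commX phi s : left_linear phi ->
  (forall P, phi ('X *: P) - 'X *: phi P = opact s P) ->
  exists t, forall P, phi P = opact t P.
Proof.
move=> lphi hphi.
pose u := mkseq (fun j => (j.+1%:R^-1 : C)%:P *: s`_j) (size s).
have us : mkseq (fun j => u`_j *+ j.+1) (size u) = s.
  apply: (@eq_from_nth _ 0); rewrite !size_mkseq // => j js.
  by rewrite !nth_mkseq // -scaler_nat scalerA -polyC_natr -polyCM mulfV ?scale1r //.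
(* The zeroth coefficient [phi 1%:M] makes the difference of the two maps vanish at 1; this
   difference also commutes with x. *)
exists (phi 1%:M :: u) => P; apply/eqP; rewrite -subr_eq0; apply/eqP; move: P.
apply: left_linear_comm_eq0.
- by move=> M P Q; rewrite lphi opact_linear mulmxBr opprD addrACA.
- move=> P; have /eqP := opact_commX (phi 1%:M) u P.
  rewrite us -hphi subr_eq => /eqP ->.
  by rewrite scalerBr opprD opprB addrA addrCA subrr addr0.
rewrite opact_cons mul1mx big1 ?addr0 ?subrr // => j _.
suff -> : mderiv j.+1 (1%:M : mpoly) = 0 by rewrite mul0mx.
apply/matrixP => a b; rewrite !mxE -polyC_natr; exact: derivnC.
Qed.

(** Multiplication by [U] and [V] commutes with the scalar x, so the commutator of the composite
    with x is the same composite for an operator of lower order; induction and [opact_of_commX]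
    conclude. *)
Lemma opact_conj s (U V : mpoly) : exists t, forall P, opact t P = opact s (P *m U) *m V.
Proof.
have [n] := ubnP (size s); elim: n s => // n IH [|F s] /= sn.
  by exists [::] => P; rewrite /opact !big_ord0 mul0mx.
have [t ht] := IH (mkseq (fun j => s`_j *+ j.+1) (size s)) ltac:(by rewrite size_mkseq).
have [|P|u hu] := @opact_of_commX (fun P => opact (F :: s) (P *m U) *m V) t.
- by move=> M P Q; rewrite mulmxDl -mulmxA opact_linear mulmxDl mulmxA.
- by rewrite ht -(opact_commX F) mulmxBl -!scalemxAl.
by exists u => P; rewrite hu.
Qed.

End DifferentialOperators.

(** * Conjugate transposition *)

Section ConjugateTranspose.
Variable R : realType.
Local Notation C := R[i].

Lemma ctrD m n (M M' : 'M[C]_(m, n)) : ctr (M + M') = ctr M + ctr M'.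
Proof. by rewrite /ctr map_mxD linearD. Qed.

Lemma ctrM m n p (M : 'M[C]_(m, n)) (M' : 'M[C]_(n, p)) :
  ctr (M *m M') = ctr M' *m ctr M.
Proof. by rewrite /ctr map_mxM trmx_mul. Qed.

Lemma ctrK m n (M : 'M[C]_(m, n)) : ctr (ctr M) = M.
Proof. by apply/matrixP => i j; rewrite !mxE conjcK. Qed.

Lemma ctr0 m n : ctr (0 : 'M[C]_(m, n)) = 0.
Proof. by rewrite /ctr map_mx0 trmx0. Qed.

End ConjugateTranspose.

(** * Matrix-valued inner products, orthogonal polynomials and adjoints *)

Section MatrixForms.
Variables (R : realType) (N : nat).
Local Notation C := R[i].
Local Notation mpoly := (mpoly R N).
Local Notation lift := (map_mx (@polyC C)).
Implicit Types (P Q : mpoly) (M : 'M[C]_N) (s : diffop R N).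

(** The properties of a weight's inner product on which the algebra rests. Abstracting them lets the
    same lemmas serve a form and its conjugate by T. *)
Record matrix_form (ip : mpoly -> mpoly -> 'M[C]_N) : Prop := MatrixForm {
  form_lin : forall M P P' Q, ip (lift M *m P + P') Q = M *m ip P Q + ip P' Q;
  form_herm : forall P Q, ip Q P = ctr (ip P Q);
  form_mulX : forall P Q, ip ('X *: P) Q = ip P ('X *: Q);
  form_eq0 : forall P, ip P P = 0 -> P = 0 }.

Definition form_monic_OP (ip : mpoly -> mpoly -> 'M[C]_N) n P :=
  mmonic n P /\ forall Q, mdeg_lt n Q -> ip P Q = 0.

Lemma matrix_form_conj ip (U V : mpoly) : U *m V = 1%:M ->
  matrix_form ip -> matrix_form (fun P Q => ip (P *m U) (Q *m U)).
Proof.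
move=> UV [lin herm mulX eq0]; split=> [M P P' Q|P Q|P Q|P] /=.
- by rewrite mulmxDl -mulmxA lin.
- by rewrite herm.
- by rewrite -!scalemxAl mulX.
- by move=> /eq0 /(congr1 (mulmx^~ V)); rewrite -mulmxA UV mulmx1 mul0mx.
Qed.

Section Form.
Variable ip : mpoly -> mpoly -> 'M[C]_N.
Hypothesis form_ip : matrix_form ip.

Lemma formDl P P' Q : ip (P + P') Q = ip P Q + ip P' Q.
Proof. by have := form_lin form_ip 1%:M P P' Q; rewrite lift1 !mul1mx. Qed.

Lemma form0l Q : ip 0 Q = 0.
Proof.
by have /eqP := formDl 0 0 Q; rewrite addr0 -subr_eq0 opprD addNKr oppr_eq0 => /eqP.
Qed.

Lemma formMl M P Q : ip (lift M *m P) Q = M *m ip P Q.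
Proof. by rewrite -[_ *m P]addr0 (form_lin form_ip) form0l addr0. Qed.

Lemma formBl P P' Q : ip (P - P') Q = ip P Q - ip P' Q.
Proof.
have := formMl (- 1%:M) P' Q.
by rewrite liftN lift1 !mulNmx !mul1mx formDl => ->.
Qed.

Lemma formDr P Q Q' : ip P (Q + Q') = ip P Q + ip P Q'.
Proof. by rewrite (form_herm form_ip) formDl ctrD -!(form_herm form_ip). Qed.

Lemma form0r P : ip P 0 = 0.
Proof. by rewrite (form_herm form_ip) form0l ctr0. Qed.

Lemma formMr M P Q : ip P (lift M *m Q) = ip P Q *m ctr M.
Proof. by rewrite (form_herm form_ip) formMl ctrM -(form_herm form_ip). Qed.

Lemma formBr P Q Q' : ip P (Q - Q') = ip P Q - ip P Q'.
Proof.
have := formDr P (Q - Q') Q'; rewrite subrK => ->.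
by rewrite addrK.
Qed.

Lemma form_inj Q Q' : (forall P, ip P Q = ip P Q') -> Q = Q'.
Proof.
move=> h; apply/eqP; rewrite -subr_eq0; apply/eqP/(form_eq0 form_ip).
by rewrite formBr h subrr.
Qed.

(** If K kills the norm of [P] from the left, then KP has norm zero, hence KP = 0, and its leading
    coefficient is K. *)
Lemma form_monic_norm_unit n P : mmonic n P -> ip P P \in unitmx.
Proof.
move=> /mmonicP[_ cP]; rewrite -row_free_unit -kermx_eq0; apply/eqP.
set K := kermx _; have /(form_eq0 form_ip) : ip (lift K *m P) (lift K *m P) = 0.
  by rewrite formMl formMr mulmxA mulmx_ker mul0mx.
by move=> /(congr1 (coefmx n)); rewrite coefmx_liftM cP mulmx1 => ->;
  apply/matrixP => i j; rewrite !mxE coef0.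
Qed.

Let functional (f : mpoly -> 'M[C]_N) :=
  forall M P Q, f (lift M *m P + Q) = M *m f P + f Q.

(** The projection of [Q] represents the functional sending P to [ip P Q]. Riesz representation in
    degree < n enters as a hypothesis so that this can be used inside the induction proving it. *)
Lemma form_projection n Q :
  (forall f, functional f ->
    exists q, mdeg_lt n q /\ forall P, mdeg_lt n P -> f P = ip P q) ->
  exists q, mdeg_lt n q /\ forall P, mdeg_lt n P -> ip P (Q - q) = 0.
Proof.
move=> /(_ (fun P => ip P Q))[|q [dq hq]].
  by move=> M P P'; exact: form_lin.
by exists q; split=> // P dP; rewrite formBr hq // subrr.
Qed.

(** Gram-Schmidt: x^n minus its projection onto degree < n. *)
Lemma form_monic_OP_of_projection n :
  (forall Q, exists q, mdeg_lt n q /\ forall P, mdeg_lt n P -> ip P (Q - q) = 0) ->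
  exists B, form_monic_OP ip n B.
Proof.
move=> /(_ ('X^n *: 1%:M))[u [/mdeg_ltP du hu]].
exists ('X^n *: 1%:M - u); split; last first.
  by move=> Q /hu; rewrite (form_herm form_ip) => h; rewrite -[LHS]ctrK h ctr0.
have cX k : coefmx k ('X^n *: 1%:M) = (k == n)%:R%:M.
  apply/matrixP => i j; rewrite !mxE.
  by case: eqVneq => _; rewrite ?mulr1n ?mulr0n ?mulr1 ?mulr0 ?coefXn ?coef0.
apply/mmonicP; split.
  apply/mdeg_ltP => k nk; rewrite coefmxB cX du ?subr0 ?(ltnW nk) //.
  by rewrite gtn_eqF //; apply/matrixP => i j; rewrite !mxE mul0rn.
by rewrite coefmxB cX eqxx du // subr0.
Qed.

(** Induction on [n]: representation in degree < n yields projections, hence the orthogonal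
    polynomial [B] of degree n, and the representative is corrected along [B]. *)
Lemma form_riesz n f : functional f ->
  exists q, mdeg_lt n q /\ forall P, mdeg_lt n P -> f P = ip P q.
Proof.
elim: n f => [|n IH] f lf.
  exists 0; split; first exact: mdeg_lt_zero.
  move=> P /mdeg_lt0 ->; rewrite form0r.
  have := lf 1%:M 0 0; rewrite lift1 !mul1mx addr0 => /eqP.
  by rewrite -subr_eq0 opprD addNKr oppr_eq0 => /eqP.
have [B [mB oB]] := form_monic_OP_of_projection
  (fun Q => @form_projection n Q IH).
have [q [dq hq]] := IH f lf.
have uB := form_monic_norm_unit mB.
(* Chosen so that the product of [ip B B] and [ctr H], which is the pairing of [B] with HB, equals
   [f B]. *)
pose H := ctr (invmx (ip B B) *m f B).
exists (lift H *m B + q); split.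
  by apply: mdeg_lt_lin; [case/mmonicP: mB|exact: mdeg_ltW dq].
move=> P dP; have dP' := mdeg_ltS_monic mB dP.
rewrite -[P in LHS](subrK (lift (coefmx n P) *m B)) addrC lf (hq _ dP').
rewrite -[P in RHS](subrK (lift (coefmx n P) *m B)) [X in _ = ip X _]addrC (form_lin form_ip).
rewrite !formDr !formMr (oB q) // /H ctrK mulKVmx // addr0.
by rewrite (form_herm form_ip B (_ - _)) (oB _ dP') ctr0 mul0mx add0r.
Qed.

Lemma form_monic_OP_ex n : exists B, form_monic_OP ip n B.
Proof. by apply: form_monic_OP_of_projection => Q; exact: form_projection (@form_riesz n). Qed.

Lemma adjoint_left_linear s psi :
  (forall P Q, ip (opact s P) Q = ip P (psi Q)) -> left_linear psi.
Proof.
move=> h M P Q; apply: form_inj => P'.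
by rewrite -h !formDr !formMr !h.
Qed.

(* x is symmetric for the form, so the adjoint of [D, x] is [x, D^*]: commuting with x
   lowers the order of D^* along with that of D. *)
Lemma adjoint_opact s psi :
  (forall P Q, ip (opact s P) Q = ip P (psi Q)) ->
  exists t, forall Q, psi Q = opact t Q.
Proof.
have [n] := ubnP (size s); elim: n s psi => // n IH [|F s] psi /= sn hpsi.
  exists [::] => Q; apply: form_inj => P.
  by rewrite -hpsi /opact !big_ord0 form0l form0r.
have lpsi := adjoint_left_linear hpsi.
have [|P Q|t ht] := IH (mkseq (fun j => s`_j *+ j.+1) (size s))
    (fun Q => 'X *: psi Q - psi ('X *: Q)).
- by rewrite size_mkseq.
- by rewrite -(opact_commX F) formBl formBr hpsi !(form_mulX form_ip) hpsi.
(* The commutators of [psi] and of its form-adjoint with x have opposite signs, so the operator is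
   first found for [- psi]. *)
have [|P|u hu] := @opact_of_commX _ _ (fun Q => - psi Q) t.
- by move=> M P Q; rewrite lpsi opprD mulmxN.
- by rewrite -ht scalerN opprK addrC.
(* The right factor -1 restores the sign. *)
have [v hv] := opact_conj u 1%:M (- 1%:M).
by exists v => Q; rewrite hv mulmx1 -hu mulmxN mulmx1 opprK.
Qed.

(** * Operators with the orthogonal polynomials as eigenfunctions *)

Section EigenOperator.
Variable D : diffop R N.
Hypothesis DW : forall n P, form_monic_OP ip n P ->
  exists L : 'M[C]_N, opact D P = lift L *m P.

(** The orthogonal polynomials of degree < n span this space over left constants, and [D] multiplies
    each by a constant matrix. *)
Lemma eigen_mdeg_lt n P : mdeg_lt n P -> mdeg_lt n (opact D P).
Proof.
elim: n P => [|n IH] P dP.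
  by rewrite (mdeg_lt0 dP) (left_linear0 (@opact_linear _ _ D)); exact: mdeg_lt_zero.
have [B oB] := form_monic_OP_ex n.
rewrite -[P](subrK (lift (coefmx n P) *m B)) addrC opact_linear.
have [L ->] := DW oB; rewrite mulmxA -liftM.
apply: mdeg_lt_lin; first by case: oB => /mmonicP[].
by apply: mdeg_ltW (leqnSn n) _; apply: IH; apply: mdeg_ltS_monic dP; case: oB.
Qed.

(** Induction on the degree of [P]: remove the leading term along an orthogonal polynomial of degree
    m >= n, which is itself orthogonal to degree < n. Once the degree drops below n, [P] is
    orthogonal to itself and vanishes. *)
Lemma eigen_orthogonal n P : (forall Q, mdeg_lt n Q -> ip P Q = 0) ->
  forall Q, mdeg_lt n Q -> ip (opact D P) Q = 0.
Proof.
have [m] := mdeg_lt_ex P; elim: m P => [|m IH] P dP oP Q dQ.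
  by rewrite (mdeg_lt0 dP) (left_linear0 (@opact_linear _ _ D)) form0l.
have [mn|nm] := ltnP m n.
  suff -> : P = 0 by rewrite (left_linear0 (@opact_linear _ _ D)) form0l.
  by apply: (form_eq0 form_ip); apply: oP; exact: mdeg_ltW dP.
have [B oB] := form_monic_OP_ex m; have [mB oB'] := oB.
have oBn Q' : mdeg_lt n Q' -> ip B Q' = 0 by move=> d; apply: oB'; exact: mdeg_ltW d.
rewrite -[P](subrK (lift (coefmx m P) *m B)) addrC opact_linear.
have [L ->] := DW oB.
rewrite formDl !formMl oBn // !mulmx0 add0r.
apply: IH => //; first exact: mdeg_ltS_monic.
by move=> Q' dQ'; rewrite formBl formMl oBn // mulmx0 oP // subr0.
Qed.

(** For [Q] of degree < n, Riesz gives q of degree < n with [ip (opact D P) Q = ip P q] for P of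
    degree < n. For general P the component orthogonal to degree < n contributes zero to both sides,
    so q is the adjoint value at [Q]. *)
Lemma eigen_adjoint : exists Dd : diffop R N,
  (forall P Q, ip (opact D P) Q = ip P (opact Dd Q)) /\
  (forall n Q, mdeg_lt n Q -> mdeg_lt n (opact Dd Q)).
Proof.
have adj n Q : mdeg_lt n Q ->
    exists q, mdeg_lt n q /\ forall P, ip (opact D P) Q = ip P q.
  move=> dQ.
  have [|q [dq hq]] := @form_riesz n (fun P => ip (opact D P) Q).
    by move=> M P P'; rewrite opact_linear form_lin.
  exists q; split=> // P.
  have [p [dp hp]] := form_projection P (@form_riesz n).
  have oPp Q' : mdeg_lt n Q' -> ip (P - p) Q' = 0.
    by move=> /hp h; rewrite (form_herm form_ip) h ctr0.
  rewrite -[P](subrK p) (left_linearD _ _ (@opact_linear _ _ D)) !formDl -(hq _ dp).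
  by rewrite (eigen_orthogonal oPp dQ) -formDl (oPp _ dq).
have [psi hpsi] : {psi : mpoly -> mpoly | forall P Q, ip (opact D P) Q = ip P (psi Q)}.
  apply: cid; suff /choice[psi hpsi] :
    forall Q, exists q, forall P, ip (opact D P) Q = ip P q by exists psi.
  by move=> Q; have [n /adj[q [_ hq]]] := mdeg_lt_ex Q; exists q.
have [Dd hDd] := adjoint_opact hpsi; exists Dd; split.
  by move=> P Q; rewrite hpsi hDd.
(* The adjoint value is unique, so it inherits the degree bound from the Riesz representative for
   this n. *)
move=> n Q /adj[q [dq hq]].
suff -> : opact Dd Q = q by [].
by apply: form_inj => P; rewrite -hDd -hpsi hq.
Qed.

End EigenOperator.

(** Subtracting from EP the multiple of [P] with the same coefficient of x^n leaves a remainder of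
    degree < n. Moving [E] to the other side as [Ed] shows that this remainder is orthogonal to
    itself. *)
Lemma form_eigen E Ed : (forall P Q, ip (opact E P) Q = ip P (opact Ed Q)) ->
  (forall n P, mdeg_lt n P -> mdeg_lt n (opact E P)) ->
  (forall n P, mdeg_lt n P -> mdeg_lt n (opact Ed P)) ->
  forall n P, form_monic_OP ip n P -> exists L : 'M[C]_N, opact E P = lift L *m P.
Proof.
move=> adj dE dEd n P [mP oP].
exists (coefmx n (opact E P)); apply/eqP; rewrite -subr_eq0; apply/eqP.
have dEP : mdeg_lt n.+1 (opact E P) by apply: dE; case/mmonicP: mP.
have d := mdeg_ltS_monic mP dEP.
apply: (form_eq0 form_ip); rewrite formBl formMl adj.
by rewrite oP ?oP ?mulmx0 ?subrr //; exact: dEd.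
Qed.

End Form.
End MatrixForms.

(** * Conjugation by T and diagonal operators *)

Section Conjugation.
Variables (R : realType) (N : nat).
Local Notation C := R[i].
Local Notation mpoly := (mpoly R N).
Local Notation lift := (map_mx (@polyC C)).
Implicit Types (P Q : mpoly) (A : 'M[C]_N) (s : diffop R N).

(** With 0-based indices, a nonzero entry has an even row and an odd column, so j cannot be both the
    column of one and the row of another. *)
Lemma in_calA_mul0 A i j k : in_calA A -> A i j * A j k = 0.
Proof.
move=> hA; have [->|/hA[oi ij]] := eqVneq (A i j) 0; first by rewrite mul0r.
have [->|/hA[oj _]] := eqVneq (A j k) 0; first by rewrite mulr0.
by case: ij oj oi => /eqP -> /=; case: (odd _).
Qed.

Lemma in_calA_diag A i : in_calA A -> A i i = 0.
Proof. by move=> /(@in_calA_mul0 _ i i i) /eqP; rewrite mulf_eq0 orbb => /eqP. Qed.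

Lemma TpolyE A : Tpoly A = 1%:M + 'X *: lift A.
Proof.
apply/matrixP => i j; rewrite !mxE -mul_polyC mulrC; congr (_ + _).
by case: (i == j).
Qed.

Lemma Tpoly_inv A B : in_calA A -> A + B = 0 -> Tpoly A *m Tpoly B = 1%:M.
Proof.
move=> hA /eqP; rewrite addrC addr_eq0 => /eqP ->.
have A2 : lift A *m lift A = 0 :> mpoly.
  rewrite -liftM; suff -> : A *m A = 0 by rewrite map_mx0.
  by apply/matrixP => i j; rewrite !mxE big1 // => k _; exact: in_calA_mul0.
rewrite !TpolyE liftN mulmxDl mul1mx mulmxDr mulmx1 -scalemxAl -scalemxAr mulmxN A2.
by rewrite oppr0 !scaler0 addr0 scalerN addrNK.
Qed.

Lemma opact_diag s P i j : diag_coeffs s ->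
  opact s P i j = \sum_(k < size s) (P i j)^`(k) * s`_k j j.
Proof.
move=> hs; rewrite summxE; apply: eq_bigr => k _.
rewrite mxE (bigD1 j) //= big1 ?addr0 ?mxE // => l lj.
by have /is_diag_mxP/(_ _ _ lj) -> := hs k; rewrite mulr0.
Qed.

(* The diagonal of [T E T^-1] is [E]: cross terms carry factors [A i j * A j i = 0]. *)
Lemma diag_conj_mdeg_lt A s t : in_calA A -> diag_coeffs s ->
  (forall P, opact t P *m Tpoly A = opact s (P *m Tpoly A)) ->
  (forall n P, mdeg_lt n P -> mdeg_lt n (opact t P)) ->
  forall n P, mdeg_lt n P -> mdeg_lt n (opact s P).
Proof.
move=> hA ds hst ht n P dP i j.
(* A diagonal operator acts on column j through its j-th diagonal coefficients whatever the row, so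
   the (i,j) entry of [P] may be moved to position (j,j). *)
pose Q : mpoly := P i j *: delta_mx j j.
have dQ : mdeg_lt n Q.
  by move=> a b; rewrite !mxE; case: andb; rewrite ?mulr1 ?mulr0 ?size_poly0.
suff -> : opact s P i j = opact t Q j j by exact: ht.
have -> : opact t Q = opact s (Q *m Tpoly A) *m Tpoly (- A).
  by rewrite -hst -mulmxA Tpoly_inv ?mulmx1 // subrr.
have QT k : (Q *m Tpoly A) j k = P i j * Tpoly A j k.
  rewrite -scalemxAl mxE; congr (_ * _); rewrite mxE (bigD1 j) //= big1 => [|l lj].
    by rewrite mxE !eqxx mul1r addr0.
  by rewrite mxE eqxx (negPf lj) mul0r.
(* The term k = j carries only diagonal entries of T and its inverse, all equal to 1; the other
   terms carry [A j k] and [A k j], one of which is zero. *)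
rewrite mxE (bigD1 j) //= big1 ?addr0 => [|k kj]; rewrite (opact_diag (Q *m Tpoly A)) // QT !mxE.
  rewrite eqxx in_calA_diag // oppr0 !scale0r addr0 !mulr1.
  exact: opact_diag.
rewrite (negPf kj) eq_sym (negPf kj) polyC0 !add0r.
have /eqP := in_calA_mul0 j k j hA; rewrite mulf_eq0 => /orP[/eqP ->|/eqP ->].
  rewrite scale0r mulr0 big1 ?mul0r // => l _.
  by rewrite linear0 mul0r.
by rewrite oppr0 scale0r mulr0.
Qed.

(** The theorem for an abstract form: the second hypothesis is diagonality of the Fourier algebra,
    and orthogonality for W becomes orthogonality for the conjugated form. *)
Lemma conj_eigen ip A D : matrix_form ip ->
  (forall E Ed : diffop R N,
    (forall P Q, ip (opact E P) Q = ip P (opact Ed Q)) -> diag_coeffs E) ->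
  in_calA A ->
  (forall n P, form_monic_OP (fun P Q => ip (P *m Tpoly A) (Q *m Tpoly A)) n P ->
    exists L : 'M[C]_N, opact D P = lift L *m P) ->
  exists E : diffop R N,
    (forall n P, form_monic_OP ip n P -> exists L : 'M[C]_N, opact E P = lift L *m P) /\
    forall P, opact D P *m Tpoly A = opact E (P *m Tpoly A).
Proof.
move=> form_ip diagF hA DW.
have TV : Tpoly A *m Tpoly (- A) = 1%:M by rewrite Tpoly_inv ?subrr.
have VT := mulmx1C TV.
have form_ip' := matrix_form_conj TV form_ip.
have [Dd [adjD dDd]] := eigen_adjoint form_ip' DW.
have [E hE] := opact_conj D (Tpoly (- A)) (Tpoly A).
have [Ed hEd] := opact_conj Dd (Tpoly (- A)) (Tpoly A).
have cE P : opact D P *m Tpoly A = opact E (P *m Tpoly A).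
  by rewrite hE -[P *m _ *m _]mulmxA TV mulmx1.
have cEd P : opact Dd P *m Tpoly A = opact Ed (P *m Tpoly A).
  by rewrite hEd -[P *m _ *m _]mulmxA TV mulmx1.
have adjE P Q : ip (opact E P) Q = ip P (opact Ed Q).
  rewrite -[P](mulmx1) -[Q](mulmx1) -VT !mulmxA -cE -cEd; exact: adjD.
(* Hermitian symmetry makes [E] an adjoint of [Ed], so [Ed] is diagonal too. *)
have adjEd P Q : ip (opact Ed P) Q = ip P (opact E Q).
  by rewrite (form_herm form_ip) -adjE -(form_herm form_ip).
exists E; split=> //.
apply: (form_eigen form_ip adjE).
  apply: diag_conj_mdeg_lt cE _ => //; first exact: diagF adjE.
  exact: eigen_mdeg_lt DW.
by apply: diag_conj_mdeg_lt cEd _ => //; exact: diagF adjEd.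
Qed.

End Conjugation.

(** * Almost everywhere statements and integrals of complex-valued functions *)

#[local] Instance lebesgue_ae_filter (R : realType) :
  Filter (nbhs (almost_everywhere (@lebesgue_measure R))).
Proof. exact: (ae_filter_ringOfSetsType (@lebesgue_measure R)). Qed.

Section ComplexIntegral.
Variables (R : realType) (S : set R).
Hypothesis mS : measurable S.
Local Notation C := R[i].
Local Notation mu := (@lebesgue_measure R).
Implicit Types (f g : R -> C).

Lemma cintegrable0 : cintegrable S (fun=> 0 : C).
Proof. by split; exact: integrable0. Qed.

Lemma cintegrableD f g : cintegrable S f -> cintegrable S g ->
  cintegrable S (fun x => f x + g x).
Proof.
move=> [fr fi] [gr gi]; split.
  rewrite (_ : _ \o _ = (EFin \o (fun x => complex.Re (f x))) \+
    (EFin \o (fun x => complex.Re (g x))))%E; first exact: integrableD.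
  by apply/funext => x /=; case: (f x); case: (g x).
rewrite (_ : _ \o _ = (EFin \o (fun x => complex.Im (f x))) \+
  (EFin \o (fun x => complex.Im (g x))))%E; first exact: integrableD.
by apply/funext => x /=; case: (f x); case: (g x).
Qed.

Lemma cintegralD f g : cintegrable S f -> cintegrable S g ->
  cintegral S (fun x => f x + g x) = cintegral S f + cintegral S g.
Proof.
move=> [fr fi] [gr gi]; rewrite /cintegral.
have -> : (fun x => complex.Re (f x + g x)) =
    (fun x => complex.Re (f x) + complex.Re (g x)).
  by apply/funext => x; case: (f x); case: (g x).
have -> : (fun x => complex.Im (f x + g x)) =
    (fun x => complex.Im (f x) + complex.Im (g x)).
  by apply/funext => x; case: (f x); case: (g x).
by rewrite !RintegralD.
Qed.

Let integrable_lincomb (a b : R) (u v : R -> R) :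
  mu.-integrable S (EFin \o u) -> mu.-integrable S (EFin \o v) ->
  mu.-integrable S (EFin \o (fun x => a * u x + b * v x)).
Proof.
move=> iu iv; rewrite (_ : _ \o _ =
  (fun x => a%:E * (EFin \o u) x) \+ (fun x => b%:E * (EFin \o v) x))%E.
  by apply: integrableD => //; exact: integrableZl.
by apply/funext.
Qed.

Let Rintegral_lincomb (a b : R) (u v : R -> R) :
  mu.-integrable S (EFin \o u) -> mu.-integrable S (EFin \o v) ->
  Rintegral mu S (fun x => a * u x + b * v x) =
  a * Rintegral mu S u + b * Rintegral mu S v.
Proof.
move=> iu iv.
have iZ c w : mu.-integrable S (EFin \o w) -> mu.-integrable S (EFin \o (fun x => c * w x)).
  by move=> iw; under [_ \o _]eq_fun do rewrite EFinM; exact: integrableZl.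
by rewrite RintegralD ?RintegralZl ?iZ.
Qed.

Let ReM (c : C) f : (fun x => complex.Re (c * f x)) =
  (fun x => complex.Re c * complex.Re (f x) + - complex.Im c * complex.Im (f x)).
Proof. by apply/funext => x; case: c => a b; case: (f x) => u v /=; rewrite mulNr. Qed.

Let ImM (c : C) f : (fun x => complex.Im (c * f x)) =
  (fun x => complex.Im c * complex.Re (f x) + complex.Re c * complex.Im (f x)).
Proof. by apply/funext => x; case: c => a b; case: (f x) => u v /=; rewrite addrC. Qed.

Lemma cintegrableZ (c : C) f : cintegrable S f -> cintegrable S (fun x => c * f x).
Proof. by move=> [fr fi]; split; rewrite ?ReM ?ImM; exact: integrable_lincomb. Qed.

Lemma cintegralZ (c : C) f : cintegrable S f ->
  cintegral S (fun x => c * f x) = c * cintegral S f.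
Proof.
move=> [fr fi]; rewrite /cintegral ReM ImM !Rintegral_lincomb //.
by case: c => a b /=; rewrite mulNr [X in (_ +i* X)%C]addrC.
Qed.

Lemma cintegrable_sum (J : Type) (r : seq J) (F : J -> R -> C) :
  (forall j, cintegrable S (F j)) -> cintegrable S (fun x => \sum_(j <- r) F j x).
Proof.
move=> iF; elim: r => [|j r IH].
  by under eq_fun do rewrite big_nil; exact: cintegrable0.
by under eq_fun do rewrite big_cons; exact: cintegrableD.
Qed.

Lemma cintegral_sum (J : Type) (r : seq J) (F : J -> R -> C) :
  (forall j, cintegrable S (F j)) ->
  cintegral S (fun x => \sum_(j <- r) F j x) = \sum_(j <- r) cintegral S (F j).
Proof.
move=> iF; elim: r => [|j r IH].
  under eq_fun do rewrite big_nil.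
  by rewrite /cintegral /= big_nil /Rintegral integral0.
under eq_fun do rewrite big_cons.
by rewrite cintegralD ?big_cons ?IH //; exact: cintegrable_sum.
Qed.

Lemma cintegrable_conj f : cintegrable S f -> cintegrable S (fun x => conjc (f x)).
Proof.
move=> [fr fi]; split.
  by rewrite (_ : (fun x => _) = (fun x => complex.Re (f x))) //; apply/funext => x; case: (f x).
rewrite (_ : (fun x => _) = (fun x => 0 * complex.Re (f x) + -1 * complex.Im (f x))).
  exact: integrable_lincomb.
by apply/funext => x; case: (f x) => a b /=; rewrite mul0r add0r mulN1r.
Qed.

Lemma cintegral_conj f : cintegrable S f ->
  cintegral S (fun x => conjc (f x)) = conjc (cintegral S f).
Proof.
move=> [fr fi]; rewrite /cintegral /=.
have -> : (fun x => complex.Re (conjc (f x))) = (fun x => complex.Re (f x)).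
  by apply/funext => x; case: (f x).
have -> : (fun x => complex.Im (conjc (f x))) =
    (fun x => 0 * complex.Re (f x) + -1 * complex.Im (f x)).
  by apply/funext => x; case: (f x) => a b /=; rewrite mul0r add0r mulN1r.
by rewrite Rintegral_lincomb // mul0r add0r mulN1r.
Qed.

Let Rintegral_ae_eq (u v : R -> R) :
  mu.-integrable S (EFin \o u) -> mu.-integrable S (EFin \o v) ->
  {ae mu, forall x, S x -> u x = v x} -> Rintegral mu S u = Rintegral mu S v.
Proof.
move=> iu iv uv; congr fine; apply: ae_eq_integral => //.
- exact: measurable_int iu.
- exact: measurable_int iv.
- by apply: filterS uv => x h Sx /=; rewrite h.
Qed.

Lemma cintegral_ae_eq f g : cintegrable S f -> cintegrable S g ->
  {ae mu, forall x, S x -> f x = g x} -> cintegral S f = cintegral S g.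
Proof.
move=> [fr fi] [gr gi] fg; congr Complex; apply: Rintegral_ae_eq => //.
  by apply: filterS fg => x h Sx; rewrite h.
by apply: filterS fg => x h Sx; rewrite h.
Qed.

(** Since [u] agrees almost everywhere with its absolute value, the latter has integral zero. *)
Lemma ae_eq0_of_Rintegral_eq0 (u : R -> R) : mu.-integrable S (EFin \o u) ->
  {ae mu, forall x, S x -> 0 <= u x} -> Rintegral mu S u = 0 ->
  {ae mu, forall x, S x -> u x = 0}.
Proof.
move=> iu u0 intu.
have mu_ := measurable_int _ iu.
have : (\int[mu]_(x in S) `|(EFin \o u) x| = 0)%E.
  have -> : (\int[mu]_(x in S) `|(EFin \o u) x| = \int[mu]_(x in S) (u x)%:E)%E.
    apply: ae_eq_integral => //; first exact: (measurable_int _ (integrable_abse iu)).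
    by apply: filterS u0 => x h Sx /=; rewrite ger0_norm // h.
  rewrite -[LHS]fineK; first by congr EFin.
  exact: integrable_fin_num.
move=> /(ae_eq_integral_abs mu mS mu_); apply: filterS => x h Sx.
by have /= [] := h Sx.
Qed.

End ComplexIntegral.

(** * The inner product of a weight matrix is a matrix form *)

Section WeightForm.
Variables (R : realType) (N : nat).
Local Notation C := R[i].
Local Notation mpoly := (mpoly R N).
Local Notation lift := (map_mx (@polyC C)).
Local Notation mu := (@lebesgue_measure R).
Implicit Types (P Q : mpoly) (M : 'M[C]_N) (x : R).

Lemma conj_cx x : conjc (cx x) = cx x.
Proof. by rewrite /cx /= oppr0. Qed.

(** On the real line conjugation only affects coefficients, so integrands remain polynomials times
    entries of the weight. *)
Lemma horner_conj (p : {poly C}) x : conjc p.[cx x] = (map_poly conjc p).[cx x].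
Proof. by rewrite -[in RHS]conj_cx horner_map. Qed.

Lemma meval_lin M P Q x : meval (lift M *m P + Q) x = M *m meval P x + meval Q x.
Proof.
apply/matrixP => i j; rewrite !mxE hornerD horner_sum; congr (_ + _).
by apply: eq_bigr => k _; rewrite !mxE hornerCM.
Qed.

Lemma mevalM P Q x : meval (P *m Q) x = meval P x *m meval Q x.
Proof.
apply/matrixP => i j; rewrite !mxE horner_sum.
by apply: eq_bigr => k _; rewrite !mxE hornerM.
Qed.

Lemma meval_mulX P x : meval ('X *: P) x = cx x *: meval P x.
Proof. by apply/matrixP => i j; rewrite !mxE hornerM hornerX. Qed.

Lemma ctr_cxZ x M : ctr (cx x *: M) = cx x *: ctr M.
Proof. by apply/matrixP => i j; rewrite !mxE rmorphM; congr (_ * _); exact: conj_cx. Qed.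

Lemma finite_real_roots (p : {poly C}) : p != 0 -> finite_set [set x | p.[cx x] = 0].
Proof.
move=> p0; have [rs hrs] := closed_field_poly_normal p.
apply: (@sub_finite_set _ _ [set` [seq complex.Re z | z <- rs]]); last exact: finite_seq.
move=> x /= /eqP px; apply/mapP; exists (cx x) => //.
move: px; rewrite hrs hornerZ mulf_eq0 lead_coef_eq0 (negPf p0) /=.
by rewrite horner_prod prodf_seq_eq0 => /hasP[z zr] /=; rewrite hornerXsubC subr_eq0 => /eqP ->.
Qed.

(** A nonzero [p] has finitely many real roots, so [a, b] would be covered by two null sets despite
    its positive length. *)
Lemma poly_ae_eq0 (a b : R) (p : {poly C}) : a < b ->
  {ae mu, forall x, `[a, b]%classic x -> p.[cx x] = 0} -> p = 0.
Proof.
move=> ab hp; apply/eqP; apply: contraT => /finite_real_roots fr.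
have n2 : mu.-negligible [set x | p.[cx x] = 0].
  apply/negligibleP; last exact/countable_lebesgue_measure0/finite_set_countable.
  by apply: countable_measurable; [move=> x; exact: measurable_set1|exact: finite_set_countable].
have : mu.-negligible `[a, b]%classic.
  apply: negligibleS (negligibleU hp n2) => x abx.
  have [px|px] := pselect (p.[cx x] = 0); [by right|left => /=].
  by move=> /(_ abx).
move=> /negligibleP => /(_ (measurable_itv _)) mu0.
have : @lebesgue_measure R `[a, b]%classic = 0%E by exact: mu0.
by rewrite lebesgue_measure_itv /= lte_fin ab -EFinD => /eqP; rewrite eqe subr_eq0 gt_eqF.
Qed.

Section Weight.
Variables (I : interval R) (W : R -> 'M[C]_N).
Hypothesis hW : weight_matrix I W.
Let S : set R := [set` I].

Let mS : measurable S.
Proof. exact: measurable_itv. Qed.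

Let integrand P Q x := meval P x *m W x *m ctr (meval Q x).

Let cintegrable_integrand P Q i k : cintegrable S (fun x => integrand P Q x i k).
Proof.
have [_ [_ [_ [hm _]]]] := hW.
have hp (p : {poly C}) a b : cintegrable S (fun x => p.[cx x] * W x a b).
  under eq_fun do rewrite horner_coef mulr_suml.
  apply: cintegrable_sum => // m.
  under eq_fun do rewrite -mulrA.
  exact/cintegrableZ.
rewrite (_ : (fun x => _) = (fun x => \sum_b \sum_a
    (P i a * map_poly conjc (Q k b)).[cx x] * W x a b)); last first.
  apply/funext => x; rewrite mxE; apply: eq_bigr => b _.
  rewrite mxE mulr_suml; apply: eq_bigr => a _.
  by rewrite !mxE hornerM -horner_conj mulrAC.
by apply: cintegrable_sum => // b; exact: cintegrable_sum.
Qed.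

Lemma weight_matrix_form : matrix_form (ipW S W).
Proof.
have [[a [b [ab [Sa Sb]]]] [_ [posW _]]] := hW.
have ipE P Q i k : ipW S W P Q i k = cintegral S (fun x => integrand P Q x i k).
  by rewrite mxE.
move: (ipW S W) ipE => ip ipE; split=> [M P P' Q|P Q|P Q|P].
- apply/matrixP => i k; rewrite [LHS]ipE [RHS]mxE [(M *m _) i k]mxE [ip P' Q i k]ipE.
  rewrite (_ : (fun x => _) = (fun x => \sum_l M i l * integrand P Q x l k + integrand P' Q x i k)).
    have iM l : cintegrable S (fun x => M i l * integrand P Q x l k).
      exact: cintegrableZ.
    rewrite cintegralD //; last exact: cintegrable_sum.
    rewrite cintegral_sum //; congr (_ + _).
    by apply: eq_bigr => l _; rewrite cintegralZ // ipE.
  apply/funext => x; rewrite /integrand meval_lin !mulmxDl mxE; congr (_ + _).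
  by rewrite -!mulmxA mxE.
- apply/matrixP => i k; rewrite [RHS]mxE mxE !ipE -cintegral_conj //.
  (* The weight is hermitian only almost everywhere, hence so is the equality of integrands. *)
  apply: cintegral_ae_eq => //.
    exact/cintegrable_conj/cintegrable_integrand.
  apply: filterS posW => x hx Sx; have [hx1 _] := hx Sx.
  have -> : integrand Q P x = ctr (integrand P Q x).
    by rewrite /integrand !ctrM ctrK -hx1 mulmxA.
  by rewrite 2!mxE.
- apply/matrixP => i k; rewrite !ipE; congr cintegral; apply/funext => x.
  by rewrite /integrand !meval_mulX ctr_cxZ -!scalemxAl -scalemxAr.
(* Definiteness, row by row: the (i,i) entry of the integrand is the quadratic form of the weight at
   row i of P(x). It is nonnegative with zero integral, so it vanishes almost everywhere, and hence
   so does the row. *)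
move=> PP0; apply/matrixP => i j; rewrite mxE.
apply: (poly_ae_eq0 ab).
pose v x := row i (meval P x).
have quadE x : (v x *m W x *m ctr (v x)) 0 0 = integrand P P x i i.
  by rewrite -row_mul !mxE; apply: eq_bigr => l _; rewrite !mxE.
have pos x : posdef (W x) -> meval P x i j != 0 -> 0 < integrand P P x i i.
  move=> [_ pW] pij; rewrite -quadE; apply: pW.
  by apply: contraNneq pij => /matrixP/(_ 0 j); rewrite mxE [X in _ = X]mxE => ->.
have nneg x : posdef (W x) -> 0 <= integrand P P x i i.
  move=> [_ pW]; rewrite -quadE.
  by have [->|/pW/ltW //] := eqVneq (v x) 0; rewrite !mul0mx mxE.
have re0 : {ae mu, forall x, S x -> complex.Re (integrand P P x i i) = 0}.
  apply: ae_eq0_of_Rintegral_eq0 => //.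
  - by have [] := cintegrable_integrand P P i i.
  - apply: filterS posW => x h Sx.
    have := nneg x (h Sx).
    by case: (integrand P P x i i) => ? ?; rewrite lecE /= => /andP[].
  - by move/matrixP: PP0 => /(_ i i); rewrite ipE mxE => /(congr1 (@complex.Re R)).
apply: filterS2 posW re0 => x px rx abx.
have Sx : S x.
  have := @interval_is_interval R I a b Sa Sb x; apply.
  by move: abx; rewrite /= in_itv.
apply/eqP; apply: contraT => pij.
have := pos x (px Sx); rewrite mxE => /(_ pij).
move: (rx Sx); case: (integrand P P x i i) => ? ? /= ->.
by rewrite ltcE /= ltxx andbF.
Qed.

End Weight.
End WeightForm.

Theorem theorem3p5 (R : realType) (N : nat) (I : interval R)
    (Wt W : R -> 'M[R[i]]_N) (A : 'M[R[i]]_N) :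
  weight_matrix I Wt ->
  (forall D : diffop R N, in_FRW I Wt D -> diag_coeffs D) ->
  in_calA A ->
  (forall x : R, W x = meval (Tpoly A) x *m Wt x *m ctr (meval (Tpoly A) x)) ->
  forall D : diffop R N, in_DW I W D ->
    exists Dt : diffop R N, in_DW I Wt Dt /\
      forall P : mpoly R N, opact D P *m Tpoly A = opact Dt (P *m Tpoly A).
Proof.
move=> hWt diagF hA hW D DW.
(* The factors of T in W are absorbed into the two arguments, which gives the conjugated form of
   [conj_eigen]. *)
have ipWE : ipW [set` I] W =
    fun P Q => ipW [set` I] Wt (P *m Tpoly A) (Q *m Tpoly A).
  apply/funext => P; apply/funext => Q; apply/matrixP => i k.
  rewrite [LHS]mxE [RHS]mxE; congr cintegral; apply/funext => x.
  by rewrite hW !mevalM ctrM !mulmxA.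
have diagF' (E Ed : diffop R N) :
    (forall P Q, ipW [set` I] Wt (opact E P) Q = ipW [set` I] Wt P (opact Ed Q)) ->
    diag_coeffs E.
  by move=> adj; apply: diagF; exists Ed.
have [|E [hE cE]] := conj_eigen (D := D) (weight_matrix_form hWt) diagF' hA.
  by move=> n P oP; apply: (DW n); rewrite /monic_OP ipWE.
by exists E; split; [exact: hE|exact: cE].
Qed.
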